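(* Let $\mathcal{H}$ be a complex Hilbert space with $\dim\mathcal{H}=2$, and let $T:M_2(\mathbb{C})\to M_2(\mathbb{C})$ be a bijective linear map. Then the following are equivalent. (1) There is a bijection $\psi:\operatorname{Conj}(\mathcal{H})\to\operatorname{Conj}(\mathcal{H})$ such that $T(\mathcal{S}_C)=\mathcal{S}_{\psi(C)}$ for every $C\in\operatorname{Conj}(\mathcal{H})$. (2) There is a bijection $\varphi:\mathcal{E}(\mathcal{H})\to\mathcal{E}(\mathcal{H})$ such that $T(\mathcal{D}_{\{e_n\}})=\mathcal{D}_{\varphi(\{e_n\})}$ for every $\{e_n\}\in\mathcal{E}(\mathcal{H})$. (3) There exist $c,\lambda\in\mathbb{C}\setminus\{0\}$, a linear functional $\ell$ on $\mathbb{C}^3$, and $B\in GL(3,\mathbb{R})$ such that \[T(aI+x\cdot\sigma)=c\,aI+\ell(x)I+\lambda\,(Bx)\cdot\sigma\] for all $a\in\mathbb{C}$ and $x\in\mathbb{C}^3$.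
   Context: $\mathcal{H}$ is identified with $\mathbb{C}^2$ (via a fixed orthonormal basis) and $\mathcal{B}(\mathcal{H})$ with the $2\times 2$ complex matrices $M_2(\mathbb{C})$; $I$ is the identity. A conjugation on $\mathcal{H}$ is an antilinear map $C:\mathcal{H}\to\mathcal{H}$ with $C^{-1}=C$ and $\langle Cx,Cy\rangle=\langle y,x\rangle$ for all $x,y\in\mathcal{H}$; $\operatorname{Conj}(\mathcal{H})$ is the set of all conjugations. For $C\in\operatorname{Conj}(\mathcal{H})$, $\mathcal{S}_C=\{A\in\mathcal{B}(\mathcal{H}) : CAC=A^*\}$ is the set of $C$-symmetric operators. $\mathcal{E}(\mathcal{H})$ is the set of all orthonormal bases of $\mathcal{H}$, regarded as ordered sequences (so reordering a basis gives a different element). For $\{e_n\}\in\mathcal{E}(\mathcal{H})$, $\mathcal{D}_{\{e_n\}}$ is the set of operators having a diagonal matrix with respect to $\{e_n\}$. The Pauli matrices are $\sigma_1=\begin{pmatrix}0&1\\1&0\end{pmatrix}$, $\sigma_2=\begin{pmatrix}0&-i\\i&0\end{pmatrix}$, $\sigma_3=\begin{pmatrix}1&0\\0&-1\end{pmatrix}$, and $x\cdot\sigma=x_1\sigma_1+x_2\sigma_2+x_3\sigma_3$ for $x=(x_1,x_2,x_3)\in\mathbb{C}^3$. Every matrix in $M_2(\mathbb{C})$ is uniquely of the form $aI+x\cdot\sigma$ with $a\in\mathbb{C}$, $x\in\mathbb{C}^3$. $GL(3,\mathbb{R})$ is the group of invertible real $3\times3$ matrices, acting on $\mathbb{C}^3$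 by matrix multiplication. *)

(* Defs.v *)
From HB Require Import structures.
From mathcomp Require Import all_boot all_order all_algebra.
From mathcomp Require Import complex.
From mathcomp Require Import boolp classical_sets functions reals.

Set Implicit Arguments.
Unset Strict Implicit.
Unset Printing Implicit Defensive.

Import Order.TTheory GRing.Theory Num.Theory.
Local Open Scope ring_scope.
Local Open Scope complex_scope.
Local Open Scope sesquilinear_scope.
Local Open Scope classical_set_scope.

Section HilbertC2.
Variable R : realType.
Local Notation C := R[i].
Local Notation H := 'cV[C]_2.

(* Linear in the first argument, conjugate-linear in the second. *)
Definition inner (x y : H) : C := \sum_(i < 2) x i 0 * (y i 0)^*%R.

Definition antilinear (J : H -> H) : Prop :=
  forall (a : C) (x y : H), J (a *: x + y) = a^*%R *: J x + J y.

Definition Conj : set (H -> H) :=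
  [set J | [/\ antilinear J, involutive J &
               forall x y, inner (J x) (J y) = inner y x]].

(* The operators A with J A J = A^*, matrices acting on column vectors. *)
Definition symmetric_ops (J : H -> H) : set 'M[C]_2 :=
  [set A | forall x, J (A *m J x) = A ^t* *m x].

(* Orthonormal bases are ordered: a permuted basis is a different tuple. *)
Definition orthonormal_bases : set (2.-tuple H) :=
  [set e : 2.-tuple H | basis_of fullv e /\
           forall i j : 'I_2, inner (tnth e i) (tnth e j) = (i == j)%:R].

(* The matrix of A with respect to an orthonormal basis e, with entries
   <A e_j, e_i>. *)
Definition matrix_wrt (e : 2.-tuple H) (A : 'M[C]_2) : 'M[C]_2 :=
  \matrix_(i, j) inner (A *m tnth e j) (tnth e i).

Definition diagonal_ops (e : 2.-tuple H) : set 'M[C]_2 :=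
  [set A | is_diag_mx (matrix_wrt e A)].

Definition sigma1 : 'M[C]_2 :=
  \matrix_(i, j) (if i == j then 0 else 1).

Definition sigma2 : 'M[C]_2 :=
  \matrix_(i, j) (if i == j then 0 else if i == 0 then - 'i%C else 'i%C).

Definition sigma3 : 'M[C]_2 :=
  \matrix_(i, j) (if i == j then if i == 0 then 1 else -1 else 0).

(* Coordinates are numbered from 0. *)
Definition dot_sigma (x : 'cV[C]_3) : 'M[C]_2 :=
  x (inord 0) 0 *: sigma1 + x (inord 1) 0 *: sigma2 + x (inord 2) 0 *: sigma3.

End HilbertC2.

(* Main.v *)
Require Import Defs.
From HB Require Import structures.
From mathcomp Require Import all_boot all_order all_algebra.
From mathcomp Require Import complex ring.
From mathcomp Require Import boolp classical_sets functions reals.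

Set Implicit Arguments.
Unset Strict Implicit.

Import Order.TTheory GRing.Theory Num.Theory.
Local Open Scope ring_scope.
Local Open Scope complex_scope.
Local Open Scope classical_set_scope.

(** In Pauli coordinates [a%:M + dot_sigma x] the two kinds of families become
    elementary geometry of the real 3-space.

    A conjugation is [x |-> dot_sigma w *m sigma2 *m conj x] for a vector [w] that
    is a unimodular multiple of a real unit vector [n], and its symmetric
    operators are those with [x] orthogonal to [n] ([symmetric_ops_planes]).  The
    operators diagonal in an orthonormal basis are those commuting with one
    non-scalar Hermitian matrix, that is, those with [x] parallel to one real
    vector [m] ([diagonal_ops_axes]).  Every real plane and every real axis
    occurs.

    The conjugations sharing a plane, or the bases sharing an axis, are
    permuted simply transitively by a group that is the same for all planes, or
    all axes: unimodular scalars for conjugations, and for bases monomial unitary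
    matrices acting on the right.  Hence a permutation of the planes lifts to
    a bijection of the conjugations, and likewise for bases ([lift_bijP]).  So
    the first condition says that [T] permutes the real planes, and the second
    that it permutes the real axes.

    It remains to go around a cycle for [T].  The real axes are exactly the
    intersections of two distinct real planes, so permuting planes implies
    permuting axes ([permutes_planes_axes]).  If [T] permutes the axes, it fixes
    their common line of scalar matrices and induces on the Pauli coordinates an
    invertible complex matrix [A] sending each real vector to a complex multiple
    of a real one.  Then every real vector is an eigenvector of
    [invmx A *m conj A], which must be scalar, and this forces [A] to be a
    complex multiple of a real matrix ([real_up_to_scalar]); that is the third
    condition.  Finally, a map [lambda B] with [B] real sends the plane
    orthogonal to [B^T w] onto the plane orthogonal to [w], so the third condition
    implies that planes are permuted ([triangular_permutes_planes]). *)

(** * Linear maps as matrices *)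

Lemma linear_mx (K : comPzRingType) m n (f : 'cV[K]_m -> 'cV[K]_n) :
  linear f -> exists A : 'M[K]_(n, m), forall x, f x = A *m x.
Proof.
move=> lf.
pose F : {linear _ -> _} := HB.pack f (GRing.isLinear.Build _ _ _ _ f lf).
exists (\matrix_(i, j) f (delta_mx j 0) i 0) => x.
rewrite [in LHS](matrix_sum_delta x) -[f]/(F : _ -> _) linear_sum.
apply/colP => i; rewrite summxE mxE; apply: eq_bigr => j _.
by rewrite big_ord1 linearZ !mxE mulrC.
Qed.

Lemma mulmx_inj (K : comPzRingType) m n (A B : 'M[K]_(m, n)) :
  (forall x : 'cV_n, A *m x = B *m x) -> A = B.
Proof.
move=> AB; apply/matrixP => i j; have := AB (delta_mx j 0).
by rewrite -!colE => /colP/(_ i); rewrite !mxE.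
Qed.

Lemma unitmx_ker0 (K : fieldType) n (A : 'M[K]_n) :
  (forall x : 'cV_n, A *m x = 0 -> x = 0) -> A \in unitmx.
Proof.
move=> A0; rewrite -unitmx_tr -row_free_unit; apply: inj_row_free => v vA.
by apply: trmx_inj; rewrite trmx0; apply: A0; rewrite -[A]trmxK -trmx_mul vA trmx0.
Qed.

(** * Complex multiples of real matrices *)

Section RealUpToScalar.
Variable R : realType.
Local Notation C := R[i].
Local Notation "A ^cj" := (map_mx Num.conj A) (at level 2, format "A ^cj").
Local Notation "v %:CV" := (map_mx (real_complex R) v) (at level 2, format "v %:CV").

Lemma conj_realC (a : R) : (a%:C : C)^*%R = a%:C.
Proof. by apply/eqP; rewrite eq_complex /= oppr0 !eqxx. Qed.

Lemma conj_eq_real (z : C) : z^*%R = z -> exists a : R, z = a%:C.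
Proof.
case: z => a b /eqP; rewrite eq_complex /= eqxx /= -subr_eq0 -opprD oppr_eq0.
by rewrite -mulr2n mulrn_eq0 /= => /eqP->; exists a.
Qed.

Lemma map_conjK m n (A : 'M[C]_(m, n)) : A^cj^cj = A.
Proof. by apply/matrixP => i j; rewrite !mxE conjCK. Qed.

(** Dividing by a nonzero entry makes all entries fixed by conjugation, since
    the factor [a] cancels in the quotients. *)
Lemma conj_collinear_real m n (W : 'M[C]_(m, n)) (a : C) :
  W != 0 -> W^cj = a *: W ->
  exists (z : C) (V : 'M[R]_(m, n)), [/\ z != 0, V != 0 & W = z *: V%:CV].
Proof.
move=> W0; have /matrix0Pn[i [j Wij]] := W0; move=> WaW.
have E k l : (W k l)^*%R = a * W k l by have /matrixP/(_ k l) := WaW; rewrite !mxE.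
have a0 : a != 0.
  by apply: contraNneq Wij => a0; rewrite -conjC_eq0 E a0 mul0r.
have real k l : exists b : R, W k l / W i j = b%:C.
  by apply: conj_eq_real; rewrite fmorph_div /= !E -mulf_div divff // mul1r.
pose V := \matrix_(k, l) projT1 (cid (real k l)).
have WV : W = W i j *: V%:CV.
  apply/matrixP => k l; rewrite !mxE; case: cid => b /= <-.
  by rewrite mulrCA divff ?mulr1.
exists (W i j), V; split => //.
by apply: contraNneq W0 => V0; rewrite WV V0 map_mx0 scaler0.
Qed.

(** Testing on the basis vectors shows that [M] is diagonal, testing on sums of
    two of them that its diagonal entries agree. *)
Lemma scalar_of_real_eigen n (M : 'M[C]_n.+1) :
  (forall v : 'cV[R]_n.+1, exists a, M *m v%:CV = a *: v%:CV) ->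
  M = (M 0 0)%:M.
Proof.
move=> eig.
have off i j : i != j -> M i j = 0.
  move=> ij; have [a] := eig (delta_mx j 0); rewrite map_delta_mx -colE => /colP/(_ i).
  by rewrite !mxE (negPf ij) mulr0.
have diag i : M i i = M 0 0.
  have [->//|i0] := eqVneq i 0.
  have [a] := eig (delta_mx i 0 + delta_mx 0 0).
  have i0' : 0 != i by rewrite eq_sym.
  rewrite map_mxD !map_delta_mx mulmxDr -!colE => /colP E; move: (E i) (E 0).
  rewrite !mxE !eqxx (negPf i0) (negPf i0') (off i 0 i0) (off 0 i i0') /=.
  by rewrite !(addr0, add0r) mulr1 => -> ->.
apply/matrixP => i j; rewrite mxE; case: eqVneq => [<-|/off->//].
by rewrite diag.
Qed.

(** If [A v = z w] with [v], [w] real, then [conj A v] is the conjugate of [A v],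
    hence a multiple of [A v].  So each real [v] is an eigenvector of
    [invmx A *m conj A], and [conj A] is a scalar multiple of [A]. *)
Lemma real_up_to_scalar n (A : 'M[C]_n.+1) : A \in unitmx ->
  (forall v : 'cV[R]_n.+1, v != 0 ->
     exists z (w : 'cV[R]_n.+1), A *m v%:CV = z *: w%:CV) ->
  exists z (B : 'M[R]_n.+1), [/\ z != 0, B \in unitmx & A = z *: B%:CV].
Proof.
move=> Au Areal; pose M := invmx A *m A^cj.
have MA : A^cj = A *m M by rewrite mulmxA mulmxV // mul1mx.
have conj_real (v : 'cV[R]_n.+1) : v%:CV^cj = v%:CV.
  by rewrite -map_mx_comp (eq_map_mx _ conj_realC).
have Ms : M = (M 0 0)%:M.
  apply: scalar_of_real_eigen => v.
  have [->|v0] := eqVneq v 0; first by exists 0; rewrite map_mx0 mulmx0 scaler0.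
  have [z [w zw]] := Areal v v0.
  have z0 : z != 0.
    apply: contra_neq v0 => z0; apply: (map_mx_inj (f := real_complex R)).
    by rewrite -[LHS](mulKmx Au) zw z0 scale0r mulmx0 map_mx0.
  have vE : v%:CV = z *: (invmx A *m w%:CV) by rewrite scalemxAr -zw mulKmx.
  exists (z^*%R / z); rewrite -mulmxA -{1}[v%:CV]conj_real -map_mxM zw map_mxZ.
  by rewrite conj_real -scalemxAr vE scalerA divfK.
have A0 : A != 0 by apply: contraTneq Au => ->; rewrite unitmxE det0 unitr0.
have [|z [B [z0 _ AB]]] := conj_collinear_real (a := M 0 0) A0.
  by rewrite MA Ms mul_mx_scalar !mxE eqxx.
exists z, B; split=> //.
by move: Au; rewrite AB unitmxZ ?unitfE // map_unitmx.
Qed.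

End RealUpToScalar.

(** * Dot and cross products *)

Section Coordinates.
Local Notation "x @' k" := (x (inord k) 0) (at level 8, k at level 2, format "x @' k").

Definition vec3 {K : pzRingType} (a b c : K) : 'cV[K]_3 :=
  \col_k [:: a; b; c]`_k.

Lemma vec3E {K : pzRingType} (a b c : K) :
  ((vec3 a b c)@'0 = a) * ((vec3 a b c)@'1 = b) * ((vec3 a b c)@'2 = c).
Proof. by rewrite /vec3 !mxE !inordK. Qed.

Lemma vec3P {K : pzRingType} (x y : 'cV[K]_3) :
  x@'0 = y@'0 -> x@'1 = y@'1 -> x@'2 = y@'2 -> x = y.
Proof.
move=> e0 e1 e2; apply/matrixP => k j; rewrite ord1 -(inord_val k).
by case: k => -[|[|[|]]].
Qed.

Lemma sum3E {V : nmodType} (F : 'I_3 -> V) :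
  \sum_k F k = F (inord 0) + F (inord 1) + F (inord 2).
Proof.
rewrite !big_ord_recl big_ord0 addr0 addrA.
by congr (F _ + F _ + F _); apply/val_inj; rewrite /= inordK.
Qed.

Lemma sum2E {V : nmodType} (F : 'I_2 -> V) : \sum_k F k = F 0 + F 1.
Proof.
by rewrite !big_ord_recl big_ord0 addr0; congr (_ + F _); apply/val_inj.
Qed.

Lemma mx2P {T : Type} (A B : 'M[T]_2) :
  A 0 0 = B 0 0 -> A 0 1 = B 0 1 -> A 1 0 = B 1 0 -> A 1 1 = B 1 1 -> A = B.
Proof.
move=> e00 e01 e10 e11; apply/matrixP => i j.
have ordE (k : 'I_2) : k = 0 \/ k = 1.
  by case: k => -[|[|//]] kP; [left|right]; apply/val_inj.
by case: (ordE i) => ->; case: (ordE j) => ->.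
Qed.

Definition dot {K : pzRingType} (u v : 'cV[K]_3) : K := (u^T *m v) 0 0.

Lemma dotE {K : pzRingType} (u v : 'cV[K]_3) :
  dot u v = u@'0 * v@'0 + u@'1 * v@'1 + u@'2 * v@'2.
Proof. by rewrite /dot mxE sum3E !mxE. Qed.

Definition cross {K : pzRingType} (u v : 'cV[K]_3) : 'cV[K]_3 :=
  vec3 (u@'1 * v@'2 - u@'2 * v@'1) (u@'2 * v@'0 - u@'0 * v@'2)
       (u@'0 * v@'1 - u@'1 * v@'0).

(** Lagrange's triple product formula. *)
Lemma cross_cross {K : comPzRingType} (u v x : 'cV[K]_3) :
  cross (cross u v) x = dot u x *: v - dot v x *: u.
Proof. by apply: vec3P; rewrite !(vec3E, dotE, mxE); ring. Qed.

Lemma crossC {K : comPzRingType} (u v : 'cV[K]_3) : cross u v = - cross v u.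
Proof. by apply: vec3P; rewrite !(vec3E, mxE); ring. Qed.

Lemma crossZr {K : comPzRingType} (a : K) (u v : 'cV[K]_3) :
  cross u (a *: v) = a *: cross u v.
Proof. by apply: vec3P; rewrite !(vec3E, mxE); ring. Qed.

Lemma crossxx {K : comPzRingType} (u : 'cV[K]_3) : cross u u = 0.
Proof. by apply: vec3P; rewrite !(vec3E, mxE); ring. Qed.

Lemma dot_crossr {K : comPzRingType} (u v : 'cV[K]_3) : dot v (cross u v) = 0.
Proof. by rewrite !(vec3E, dotE); ring. Qed.

Lemma dotZl {K : comPzRingType} (a : K) (u v : 'cV[K]_3) :
  dot (a *: u) v = a * dot u v.
Proof. by rewrite !(dotE, mxE); ring. Qed.

Lemma dotZr {K : comPzRingType} (a : K) (u v : 'cV[K]_3) :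
  dot u (a *: v) = a * dot u v.
Proof. by rewrite !(dotE, mxE); ring. Qed.

Lemma crossZl {K : comPzRingType} (a : K) (u v : 'cV[K]_3) :
  cross (a *: u) v = a *: cross u v.
Proof. by apply: vec3P; rewrite !(vec3E, mxE); ring. Qed.

Lemma cross0r {K : comPzRingType} (u : 'cV[K]_3) : cross u 0 = 0.
Proof. by rewrite -(scale0r u) crossZr !scale0r. Qed.

Lemma dot_cross_rot {K : comPzRingType} (u v x : 'cV[K]_3) :
  dot v (cross x u) = dot x (cross u v).
Proof. by rewrite !(vec3E, dotE); ring. Qed.

Lemma dot_delta {K : comPzRingType} k (u : 'cV[K]_3) : dot (delta_mx k 0) u = u k 0.
Proof.
rewrite /dot mxE (bigD1 k) //= big1 ?addr0 => [|j /negPf jk].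
  by rewrite !mxE !eqxx mul1r.
by rewrite !mxE jk mul0r.
Qed.

Lemma cross_eq0 {K : fieldType} (u v : 'cV[K]_3) :
  u != 0 -> cross u v = 0 -> exists a, v = a *: u.
Proof.
case/cV0Pn => k uk uv0.
have uvE i j : u i 0 * v j 0 = u j 0 * v i 0.
  have E l : (cross u v)@'l = 0 by rewrite uv0 mxE.
  have := (E 0, E 1, E 2); rewrite !vec3E.
  move=> -[[/subr0_eq E0 /subr0_eq E1] /subr0_eq E2].
  have o (l : 'I_3) : [\/ l = inord 0, l = inord 1 | l = inord 2].
    rewrite -(inord_val l); case: l => -[|[|[|//]]] /= _;
    [exact: Or31 | exact: Or32 | exact: Or33].
  by case: (o i) => ->; case: (o j) => ->.
exists (v k 0 / u k 0); apply/colP => j; rewrite mxE.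
by apply: (mulfI uk); rewrite uvE mulrA mulrCA divff // mulr1 mulrC.
Qed.

(** A nonzero vector is not parallel to two different basis vectors. *)
Lemma cross_delta_neq0 {K : fieldType} (u : 'cV[K]_3) :
  u != 0 -> exists k, cross u (delta_mx k 0) != 0.
Proof.
move=> u0; have /cV0Pn[j uj] := u0; exists (lift j ord0).
apply/eqP => /(cross_eq0 u0)[a E].
have /colP/(_ j)/eqP := E; rewrite !mxE (negPf (neq_lift _ _)) eq_sym mulf_eq0.
rewrite (negPf uj) orbF => /eqP a0; have /colP/(_ (lift j ord0)) := E.
by rewrite a0 scale0r !mxE !eqxx => /eqP; rewrite oner_eq0.
Qed.

Lemma dot_mulmx {K : comPzRingType} (B : 'M[K]_3) (u v : 'cV[K]_3) :
  dot u (B *m v) = dot (B^T *m u) v.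
Proof. by rewrite /dot trmx_mul trmxK mulmxA. Qed.

End Coordinates.

(** * Pauli coordinates, planes and axes *)

Section Pauli.
Variable R : realType.
Local Notation C := R[i].
Local Notation "x @' k" := (x (inord k) 0) (at level 8, k at level 2, format "x @' k").
Local Notation "A ^cj" := (map_mx Num.conj A) (at level 2, format "A ^cj").
Local Notation "v %:CV" := (map_mx (real_complex R) v) (at level 2, format "v %:CV").

(** The coordinates on the traceless part that invert [dot_sigma]. *)
Definition pauli (A : 'M[C]_2) : 'cV[C]_3 :=
  vec3 ((A 0 1 + A 1 0) / 2) ('i%C * (A 0 1 - A 1 0) / 2) ((A 0 0 - A 1 1) / 2).

Lemma iC2 : 'i%C * 'i%C = -1 :> C.
Proof. by rewrite -expr2 sqr_i. Qed.

Lemma conj_iC : ('i%C : C)^*%R = - 'i%C.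
Proof. by apply/eqP; rewrite eq_complex /= oppr0 !eqxx. Qed.

Lemma dot_sigmaE (x : 'cV[C]_3) :
  (dot_sigma x 0 0 = x@'2) * (dot_sigma x 0 1 = x@'0 - 'i%C * x@'1) *
  (dot_sigma x 1 0 = x@'0 + 'i%C * x@'1) * (dot_sigma x 1 1 = - x@'2).
Proof. by rewrite /dot_sigma !mxE /=; split; [split; [split|]|]; ring. Qed.

Lemma pauli_decomp (A : 'M[C]_2) :
  A = ((A 0 0 + A 1 1) / 2)%:M + dot_sigma (pauli A).
Proof.
by apply: mx2P; rewrite !(dot_sigmaE, vec3E, mxE) /= ?mulr1n ?mulr0n;
  field: iC2.
Qed.

Lemma pauliK (a : C) (x : 'cV[C]_3) : pauli (a%:M + dot_sigma x) = x.
Proof.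
by apply: vec3P; rewrite vec3E !(dot_sigmaE, mxE) /= ?mulr1n ?mulr0n; field: iC2.
Qed.

Lemma dot_sigmaK (x : 'cV[C]_3) : pauli (dot_sigma x) = x.
Proof. by rewrite -[dot_sigma x]add0r -(raddf0 (@scalar_mx C 2)) pauliK. Qed.

Lemma pauli_scalar (a : C) : pauli a%:M = 0.
Proof.
by apply: vec3P; rewrite !(vec3E, mxE) /= ?mulr1n ?mulr0n; field.
Qed.

Lemma pauliD A B : pauli (A + B) = pauli A + pauli B.
Proof. by apply: vec3P; rewrite !(vec3E, mxE); field. Qed.

Lemma pauliZ a A : pauli (a *: A) = a *: pauli A.
Proof. by apply: vec3P; rewrite !(vec3E, mxE); field. Qed.

Lemma dot_sigmaD (x y : 'cV[C]_3) : dot_sigma (x + y) = dot_sigma x + dot_sigma y.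
Proof. by apply: mx2P; rewrite !(dot_sigmaE, mxE); ring. Qed.

Lemma dot_sigmaZ a (x : 'cV[C]_3) : dot_sigma (a *: x) = a *: dot_sigma x.
Proof. by apply: mx2P; rewrite !(dot_sigmaE, mxE); ring. Qed.

Lemma dot_sigma0 : dot_sigma (0 : 'cV[C]_3) = 0.
Proof. by rewrite -(scale0r 0) dot_sigmaZ !scale0r. Qed.

(** The cross product is the Lie bracket of the Pauli matrices up to [2i]; this
    turns commutation into collinearity. *)
Lemma commutator_pauli (N A : 'M[C]_2) :
  N *m A - A *m N = (2 * 'i%C) *: dot_sigma (cross (pauli N) (pauli A)).
Proof.
by apply: mx2P; rewrite !(dot_sigmaE, vec3E, sum2E, mxE); field: iC2.
Qed.

Lemma pauli_commute (N A : 'M[C]_2) :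
  N *m A = A *m N <-> cross (pauli N) (pauli A) = 0.
Proof.
split=> [NA|NA0]; last first.
  by apply/subr0_eq; rewrite commutator_pauli NA0 dot_sigma0 scaler0.
have /eqP := commutator_pauli N A; rewrite NA subrr eq_sym scaler_eq0.
have i2 : 2 * 'i%C != 0 :> C.
  by rewrite mulf_neq0 ?pnatr_eq0 // eq_complex /= negb_and oner_eq0 orbT.
rewrite (negPf i2) /= => /eqP s0.
by rewrite -[LHS]dot_sigmaK s0 -dot_sigma0 dot_sigmaK.
Qed.

Lemma pauli_eq0 (A : 'M[C]_2) : pauli A = 0 -> exists a, A = a%:M.
Proof.
move=> A0; exists ((A 0 0 + A 1 1) / 2); rewrite {1}[A]pauli_decomp A0.
by rewrite dot_sigma0 addr0.
Qed.

Lemma pauli_hermitian (A : 'M[C]_2) : A^T^cj = A -> (pauli A)^cj = pauli A.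
Proof.
move=> AA; have E i j : (A i j)^*%R = A j i by rewrite -[in RHS]AA !mxE.
by apply: vec3P; rewrite !(vec3E, mxE)
  !(rmorphM, fmorphV, rmorph_nat, rmorphD, rmorphN) /= !E ?conj_iC; field.
Qed.

Lemma dot_sigma_hermitian (v : 'cV[R]_3) :
  (dot_sigma v%:CV)^T^cj = dot_sigma v%:CV.
Proof.
by apply: mx2P; rewrite !(dot_sigmaE, mxE) ?rmorphD ?rmorphN ?rmorphM /=
  ?conj_iC ?conj_realC; ring.
Qed.

(** Scalar matrices have zero Pauli coordinates, so they lie in every [plane] and
    every [axis]: as spaces of matrices these have dimensions 3 and 2. *)
Definition plane (w : 'cV[C]_3) : set 'M[C]_2 := [set A | dot w (pauli A) = 0].
Definition axis (w : 'cV[C]_3) : set 'M[C]_2 :=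
  [set A | cross w (pauli A) = 0].

Definition real_planes : set (set 'M[C]_2) :=
  [set plane v%:CV | v in [set v : 'cV[R]_3 | v != 0]].
Definition real_axes : set (set 'M[C]_2) :=
  [set axis v%:CV | v in [set v : 'cV[R]_3 | v != 0]].

Lemma planeZ z w : z != 0 -> plane (z *: w) = plane w.
Proof.
move=> z0; apply/seteqP; split=> A; rewrite /plane /= dotZl.
  by move=> /eqP; rewrite mulf_eq0 (negPf z0) /= => /eqP.
by move=> ->; rewrite mulr0.
Qed.

Lemma axisZ z w : z != 0 -> axis (z *: w) = axis w.
Proof.
move=> z0; apply/seteqP; split=> A; rewrite /axis /= crossZl.
  by move/eqP; rewrite scaler_eq0 (negPf z0) => /eqP.
by move->; rewrite scaler0.
Qed.

(** A vector parallel to its own conjugate is a complex multiple of a real one, and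
    planes and axes do not see the factor. *)
Lemma plane_axis_real (w : 'cV[C]_3) : w != 0 -> cross w w^cj = 0 ->
  real_planes (plane w) /\ real_axes (axis w).
Proof.
move=> w0 /(cross_eq0 w0) [a] /(conj_collinear_real w0).
by move=> [z [v [z0 v0 ->]]]; rewrite planeZ // axisZ //; split; exists v.
Qed.

Lemma cross_real (u v : 'cV[R]_3) : cross u%:CV v%:CV = (cross u v)%:CV.
Proof.
by apply: vec3P; rewrite !(vec3E, mxE) rmorphB !rmorphM.
Qed.

Lemma dot_real (u v : 'cV[R]_3) : dot u%:CV v%:CV = (dot u v)%:C.
Proof. by rewrite !dotE !mxE !rmorphD !rmorphM. Qed.

Lemma real_eq0 m n (V : 'M[R]_(m, n)) : (V%:CV == 0) = (V == 0).
Proof. exact: map_mx_eq0. Qed.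

(** The vectors [cross e_k u] lie in the plane orthogonal to [u]; orthogonality of
    [v] to all of them says that [cross u v] vanishes. *)
Lemma plane_dual (u v : 'cV[C]_3) :
  u != 0 -> plane u `<=` plane v -> exists a, v = a *: u.
Proof.
move=> u0 uv; apply: cross_eq0 => //; apply/colP => k; rewrite [RHS]mxE.
have := uv (0%:M + dot_sigma (cross (delta_mx k 0) u)).
by rewrite /plane /= pauliK dot_crossr dot_cross_rot dot_delta; apply.
Qed.

Lemma plane_meet (u v : 'cV[C]_3) : cross u v != 0 ->
  plane u `&` plane v = axis (cross u v).
Proof.
move=> uv; apply/seteqP; split=> A; rewrite /plane /axis /= cross_cross.
  by move=> [-> ->]; rewrite !scale0r subr0.
set x := pauli A => E.
have /eqP : dot u x *: cross u v = 0.
  rewrite -(cross0r u) -E.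
  by apply: vec3P; rewrite !(vec3E, mxE); ring.
rewrite scaler_eq0 (negPf uv) orbF => /eqP ux.
split=> //; move: E; rewrite ux scale0r sub0r => /eqP.
rewrite oppr_eq0 scaler_eq0 => /orP[/eqP//|/eqP u0].
by move: uv; rewrite u0 crossC cross0r oppr0 eqxx.
Qed.

Lemma dotxx_gt0 (u : 'cV[R]_3) : u != 0 -> 0 < dot u u.
Proof.
move=> /cV0Pn[k uk]; rewrite /dot mxE (bigD1 k) //= mxE -expr2.
apply: ltr_wpDr; last by rewrite exprn_even_gt0.
by apply: sumr_ge0 => i _; rewrite mxE -expr2 sqr_ge0.
Qed.

Lemma real_axes_planes : real_axes =
  [set L | exists P Q, [/\ real_planes P, real_planes Q, P <> Q & L = P `&` Q]].
Proof.
apply/seteqP; split=> L; last first.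
  move=> [_ [_ [[u /= u0 <-] [v /= v0 <-] PQ ->]]].
  have uv0 : cross u v != 0.
    apply: contra_not_neq PQ => /(cross_eq0 u0)[a E].
    have a0 : a != 0 by apply: contraNneq v0 => a0; rewrite E a0 scale0r.
    by rewrite E map_mxZ planeZ // fmorph_eq0.
  by rewrite plane_meet ?cross_real ?real_eq0 //; exists (cross u v).
move=> [m /= m0 <-].
have [k u0] := cross_delta_neq0 m0.
(* [u] and [m x u] are orthogonal to [m] and to each other, so the triple product
   formula gives [u x (m x u) = |u|^2 m]. *)
set u := cross _ _ in u0; set v := cross m u.
have uv : cross u v = dot u u *: m.
  by rewrite /v /u; apply: vec3P; rewrite !(vec3E, dotE, mxE); ring.
have uu := dotxx_gt0 u0.
have uv0 : cross u v != 0 by rewrite uv scaler_eq0 negb_or m0 gt_eqF.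
have v0 : v != 0 by apply: contraNneq uv0 => ->; rewrite cross0r.
exists (plane u%:CV), (plane v%:CV); split; [by exists u|by exists v| |].
  move=> PQ; have [] := @plane_dual u%:CV v%:CV; rewrite ?real_eq0 ?PQ // => a va.
  by move: uv0; rewrite -real_eq0 -cross_real va crossZr crossxx scaler0 eqxx.
rewrite plane_meet ?cross_real ?real_eq0 // uv map_mxZ axisZ //.
by rewrite fmorph_eq0 gt_eqF.
Qed.
End Pauli.

(** * Conjugations and planes *)

Section Conjugations.
Variable R : realType.
Local Notation C := R[i].
Local Notation H := 'cV[C]_2.
Local Notation sigma2 := (sigma2 R).
Local Notation "A ^cj" := (map_mx Num.conj A) (at level 2, format "A ^cj").
Local Notation "v %:CV" := (map_mx (real_complex R) v) (at level 2, format "v %:CV").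

Lemma map_conjTK (A : 'M[C]_2) : A^T^cj^T^cj = A.
Proof. by apply/matrixP => i j; rewrite !mxE conjCK. Qed.

Lemma innerE (x y : H) : inner x y = (y^T^cj *m x) 0 0.
Proof. by rewrite /inner mxE; apply: eq_bigr => i _; rewrite !mxE mulrC. Qed.

Lemma inner_conj (x y : H) : inner x^cj y^cj = inner y x.
Proof.
by rewrite /inner; apply: eq_bigr => i _; rewrite !mxE conjCK mulrC.
Qed.

Lemma inner_mulmx (A : 'M[C]_2) (x y : H) :
  inner (A *m x) y = inner x (A^T^cj *m y).
Proof.
by rewrite !innerE trmx_mul map_mxM map_conjTK mulmxA.
Qed.

Lemma inner_delta (A : 'M[C]_2) i j :
  inner (A *m delta_mx j 0) (delta_mx i 0) = A i j.
Proof.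
rewrite innerE mulmxA trmx_delta map_delta_mx -rowE.
by rewrite -colE !mxE.
Qed.

Lemma unitary_inner (U : 'M[C]_2) :
  (forall x y, inner (U *m x) (U *m y) = inner x y) <-> U^T^cj *m U = 1%:M.
Proof.
split=> [UU|UU x y]; last first.
  by rewrite inner_mulmx mulmxA UU mul1mx.
apply/matrixP => i j; rewrite -inner_delta -mulmxA inner_mulmx.
by rewrite map_conjTK UU -[delta_mx j 0]mul1mx inner_delta.
Qed.

(** [x |-> sigma2 *m conj x] is, up to a phase, the time reversal of a spin 1/2,
    which anticommutes with every [dot_sigma n], [n] real.  Composing it with
    [dot_sigma n] therefore gives an involution. *)
Definition conj_of (w : 'cV[C]_3) : H -> H :=
  fun x => dot_sigma w *m sigma2 *m x^cj.

Lemma dot_sigma_mul (u v : 'cV[C]_3) :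
  dot_sigma u *m dot_sigma v = (dot u v)%:M + 'i%C *: dot_sigma (cross u v).
Proof.
by apply: mx2P; rewrite !(dot_sigmaE, vec3E, dotE, sum2E, mxE) /=
  ?mulr1n ?mulr0n; ring: (iC2 R).
Qed.

Lemma sigma2_sq : sigma2 *m sigma2 = 1%:M.
Proof.
by apply: mx2P; rewrite !(sum2E, mxE) /=; ring: (iC2 R).
Qed.

Lemma conj_of_sq (w : 'cV[C]_3) :
  (dot_sigma w *m sigma2) *m (dot_sigma w *m sigma2)^cj =
  dot_sigma w *m dot_sigma w^cj.
Proof.
rewrite map_mxM mulmxA -!(mulmxA (dot_sigma w)); congr (_ *m _).
apply: mx2P; rewrite !(dot_sigmaE, sum2E, mxE) /= ?rmorph0 ?rmorphD ?rmorphN ?rmorphM /=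
  ?rmorph0 ?conj_iC; ring: (iC2 R).
Qed.

(** A matrix [M] is symmetric exactly when [M *m sigma2] is traceless. *)
Lemma sym_dot_sigma (M : 'M[C]_2) : M^T = M <-> exists w, M = dot_sigma w *m sigma2.
Proof.
split=> [MT|[w ->]]; last first.
  by apply: mx2P; rewrite !(dot_sigmaE, sum2E, mxE) /=; ring.
exists (pauli (M *m sigma2)).
have M10 : M 1 0 = M 0 1 by rewrite -[in RHS]MT mxE.
by apply: mx2P; rewrite !(dot_sigmaE, vec3E, sum2E, mxE) /= ?M10; field: (iC2 R).
Qed.

(** An antilinear map is [x |-> M *m conj x].  Involutivity gives
    [M *m conj M = 1] and the isometry condition makes [M] unitary; together they
    say that [M] is unitary and symmetric, and the symmetric matrices are those of
    the form [dot_sigma w *m sigma2]. *)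
Lemma ConjP (J : H -> H) : Conj J <->
  exists2 w, dot_sigma w *m dot_sigma w^cj = 1%:M & J = conj_of w.
Proof.
split=> [[Ja Ji Jo]|[w ww ->]]; last first.
  have sq x : conj_of w (conj_of w x) = x.
    by rewrite /conj_of [(_ *m x^cj)^cj]map_mxM map_conjK mulmxA conj_of_sq ww mul1mx.
  split=> // [a x y|x y].
    by rewrite /conj_of map_mxD map_mxZ mulmxDr -scalemxAr.
  rewrite /conj_of -[RHS]inner_conj; apply: (unitary_inner _).2.
  have MT : (dot_sigma w *m sigma2)^T = dot_sigma w *m sigma2.
    by apply/sym_dot_sigma; exists w.
  by rewrite MT; apply: mulmx1C; rewrite conj_of_sq.
have [M JM] : exists M : 'M[C]_2, forall x, J x^cj = M *m x.
  apply: (@linear_mx _ _ _ (fun x => J x^cj)) => c x y.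
  by rewrite map_mxD map_mxZ Ja /= conjCK.
have {}JM x : J x = M *m x^cj by rewrite -JM map_conjK.
have MM : M *m M^cj = 1%:M.
  by apply: mulmx_inj => x; rewrite mul1mx -[RHS](Ji x) !JM map_mxM map_conjK mulmxA.
have Mu : M^T^cj *m M = 1%:M.
  apply: (unitary_inner _).1 => x y; have := Jo x^cj y^cj.
  by rewrite !JM !map_conjK inner_conj.
have MT : M^T = M.
  apply: (can_inj (@map_conjK _ _ _)); have := congr1 (mulmx^~ M^cj) Mu.
  by rewrite mul1mx -mulmxA MM mulmx1.
have /sym_dot_sigma[w Mw] := MT; exists w; first by rewrite -conj_of_sq -Mw.
by apply/funext => x; rewrite JM Mw.
Qed.

Lemma conj_axis_neq0 (w : 'cV[C]_3) :
  dot_sigma w *m dot_sigma w^cj = 1%:M -> w != 0.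
Proof.
by apply: contra_eq_neq => ->; rewrite dot_sigma0 mul0mx eq_sym oner_eq0.
Qed.

(** For [J x = M *m conj x] the condition [J A J = A^*] reads
    [M *m A^T = A *m M].  Since [M] is symmetric, the difference of the two sides is
    antisymmetric, so it is one scalar equation, and it is linear in [pauli A]. *)
Lemma symmetric_ops_conj_of (w : 'cV[C]_3) : dot_sigma w *m dot_sigma w^cj = 1%:M ->
  symmetric_ops (conj_of w) = plane w.
Proof.
move=> ww; pose M := dot_sigma w *m sigma2.
have MM : M *m M^cj = 1%:M by rewrite conj_of_sq.
have MM' : M^cj *m M = 1%:M by exact: mulmx1C.
have D A : M *m A^T - A *m M = (- 2 * dot w (pauli A)) *: sigma2.
  by apply: mx2P; rewrite !(dot_sigmaE, dotE, vec3E, sum2E, mxE) /=; field: (iC2 R).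
have S A : symmetric_ops (conj_of w) A <-> M *m A^T = A *m M.
  transitivity (M *m A^cj *m M^cj = A^T^cj).
    have E x : conj_of w (A *m conj_of w x) = M *m A^cj *m M^cj *m x.
      by rewrite /conj_of -/M !map_mxM map_conjK !mulmxA.
    by split=> [SA|SA x]; [apply: mulmx_inj => x; rewrite -SA|rewrite -SA].
  transitivity (M^cj *m A *m M = A^T).
    by split=> /(congr1 (map_mx Num.conj)); rewrite !map_mxM !map_conjK.
  split=> [/(congr1 (mulmx M))|MA]; first by rewrite !mulmxA MM mul1mx.
  by rewrite -mulmxA -MA mulmxA MM' mul1mx.
apply/seteqP; split=> A; rewrite /plane /=.
  move/S/eqP; rewrite -subr_eq0 D scaler_eq0 mulf_eq0 oppr_eq0 pnatr_eq0 /=.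
  case/orP => /eqP // s0; have := sigma2_sq.
  by rewrite s0 mul0mx => /esym/eqP; rewrite oner_eq0.
by move=> wA; apply/S/subr0_eq; rewrite D wA mulr0 scale0r.
Qed.

Lemma conj_of_real (v : 'cV[R]_3) : v != 0 ->
  exists w, dot_sigma w *m dot_sigma w^cj = 1%:M /\ plane w = plane v%:CV.
Proof.
move=> v0; have vv := dotxx_gt0 v0; pose n := (Num.sqrt (dot v v))^-1.
have n0 : n != 0 by rewrite invr_eq0 sqrtr_eq0 -ltNge.
exists (n%:C *: v%:CV); split; last by rewrite planeZ // fmorph_eq0.
rewrite -map_mxZ -map_mx_comp (eq_map_mx _ (@conj_realC R)) dot_sigma_mul crossxx.
rewrite dot_real dotZl dotZr mulrA -expr2 exprVn sqr_sqrtr ?ltW // mulVf ?gt_eqF //.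
by rewrite dot_sigma0 scaler0 addr0.
Qed.

(** The normalisation [dot_sigma w *m dot_sigma (conj w) = 1] makes these two
    matrices inverse to each other, so they commute and [w] is parallel to
    [conj w], hence to a real vector. *)
Lemma symmetric_ops_planes : @symmetric_ops R @` @Conj R = @real_planes R.
Proof.
apply/seteqP; split=> [_ [J /ConjP[w ww ->] <-]|_ [v /= v0 <-]].
  rewrite symmetric_ops_conj_of //.
  have w0 : w != 0 by exact: (conj_axis_neq0 ww).
  have /(_ w0) [|//] := @plane_axis_real _ w.
  rewrite -[w^cj]dot_sigmaK -{1}[w]dot_sigmaK.
  by apply: (pauli_commute _ _).1; rewrite ww; apply/esym/mulmx1C.
have [w [ww <-]] := conj_of_real v0.
by exists (conj_of w); [apply/ConjP; exists w|exact: symmetric_ops_conj_of].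
Qed.

(** If [e] and [a] have the same symmetric operators, [e \o a] is a unimodular
    scalar, and [e \o a \o b] is the same multiple of [b] as [e] is of [a]. *)
Lemma conj_transport (a b e : H -> H) : Conj a -> Conj b -> Conj e ->
  symmetric_ops e = symmetric_ops a ->
  [/\ Conj (e \o a \o b), symmetric_ops (e \o a \o b) = symmetric_ops b
    & (e \o a \o b) \o b \o a = e].
Proof.
move=> Ca Cb Ce eaS; have [_ aK _] := Ca; have [_ bK _] := Cb.
have /ConjP[w ww aw] := Ca; have /ConjP[u uu bu] := Cb; have /ConjP[v vv ev] := Ce.
have w0 : w != 0 by exact: (conj_axis_neq0 ww).
have [|z vz] := @plane_dual _ w v w0.
  by rewrite -(symmetric_ops_conj_of ww) -(symmetric_ops_conj_of vv) -aw -ev eaS.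
have conjZ x y : conj_of (z *: x) y = z *: conj_of x y.
  by rewrite /conj_of dot_sigmaZ -!scalemxAl.
have zz : z * z^*%R = 1.
  move: vv; rewrite vz map_mxZ !dot_sigmaZ -scalemxAl -scalemxAr ww scalerA.
  by move/matrixP/(_ 0 0); rewrite !mxE eqxx mulr1n mulr1.
have z0 : z != 0 by apply: contra_eq_neq zz => ->; rewrite mul0r eq_sym oner_eq0.
have E : e \o a \o b = conj_of (z *: u).
  by apply/funext => x; rewrite /= conjZ -bu ev vz conjZ -aw aK.
have zu : dot_sigma (z *: u) *m dot_sigma (z *: u)^cj = 1%:M.
  by rewrite map_mxZ !dot_sigmaZ -scalemxAl -scalemxAr uu scalerA zz scale1r.
split.
- by rewrite E; apply/ConjP; exists (z *: u).
- by rewrite E symmetric_ops_conj_of // planeZ // -symmetric_ops_conj_of // bu.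
- by apply/funext => x; rewrite /= bK aK.
Qed.
End Conjugations.

(** * Orthonormal bases and axes *)

Section Bases.
Variable R : realType.
Local Notation C := R[i].
Local Notation H := 'cV[C]_2.
Local Notation "A ^cj" := (map_mx Num.conj A) (at level 2, format "A ^cj").
Local Notation "v %:CV" := (map_mx (real_complex R) v) (at level 2, format "v %:CV").

Definition basis_mx (e : 2.-tuple H) : 'M[C]_2 := \matrix_(i, j) tnth e j i 0.

Lemma tnth_basis_mx e j : tnth e j = basis_mx e *m delta_mx j 0.
Proof. by apply/colP => i; rewrite -colE !mxE. Qed.

Lemma basis_mx_inj : injective basis_mx.
Proof.
by move=> e f ef; apply: eq_from_tnth => j; rewrite !tnth_basis_mx ef.
Qed.

Lemma basis_mx_surj U : exists e, basis_mx e = U.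
Proof.
by exists [tuple col j U | j < 2]; apply/matrixP => i j; rewrite mxE tnth_mktuple mxE.
Qed.

Lemma basis_mx_map (V : 'M[C]_2) e : basis_mx (map_tuple (mulmx V) e) = V *m basis_mx e.
Proof.
apply/matrixP => i j; rewrite mxE tnth_map !mxE.
by apply: eq_bigr => k _; rewrite mxE.
Qed.

Lemma matrix_wrtE e (A : 'M[C]_2) :
  matrix_wrt e A = (basis_mx e)^T^cj *m A *m basis_mx e.
Proof.
apply/matrixP => i j; rewrite mxE !tnth_basis_mx -inner_delta -!mulmxA.
by rewrite [RHS]inner_mulmx map_conjTK.
Qed.

Lemma orthonormal_basesP e :
  orthonormal_bases e <-> (basis_mx e)^T^cj *m basis_mx e = 1%:M.
Proof.
set U := basis_mx e.
have gram i j : inner (tnth e i) (tnth e j) = (U^T^cj *m U) j i.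
  by rewrite !tnth_basis_mx -inner_delta -!mulmxA [RHS]inner_mulmx map_conjTK.
split=> [[_ eo]|UU]; first by apply/matrixP => i j; rewrite -gram eo mxE eq_sym.
split=> [|i j]; last by rewrite gram UU mxE eq_sym.
rewrite basisEdim size_tuple dimvf /dim /= muln1 leqnn andbT.
apply/subvP => v _; have UU' : U *m U^T^cj = 1%:M by apply: mulmx1C.
rewrite -[v]mul1mx -UU' -mulmxA; set y := _ *m v.
have -> : U *m y = \sum_j y j 0 *: tnth e j.
  by apply/colP => i; rewrite mxE summxE; apply: eq_bigr => j _; rewrite !mxE mulrC.
by apply: memv_suml => j _; apply: memvZ; apply/memv_span/mem_tnth.
Qed.

Lemma diagonal_opsE e (A : 'M[C]_2) :
  diagonal_ops e A <-> is_diag_mx ((basis_mx e)^T^cj *m A *m basis_mx e).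
Proof. by rewrite -matrix_wrtE. Qed.

Lemma diag_commute (D X : 'M[C]_2) : is_diag_mx D -> D 0 0 != D 1 1 ->
  is_diag_mx X <-> D *m X = X *m D.
Proof.
move=> /is_diag_mxP Dd D01; have [D0 D1] := (Dd 0 1 isT, Dd 1 0 isT).
split=> [/is_diag_mxP Xd|DX].
  have [X0 X1] := (Xd 0 1 isT, Xd 1 0 isT).
  by apply: mx2P; rewrite !mxE !sum2E ?D0 ?D1 ?X0 ?X1; ring.
have X0 : X 0 1 = 0.
  apply: (mulfI (x := D 0 0 - D 1 1)); rewrite ?subr_eq0 // mulr0.
  move/matrixP/(_ 0 1): DX; rewrite !mxE !sum2E D0 => /eqP.
  by rewrite -subr_eq0 => /eqP E; rewrite -[RHS]E; ring.
have X1 : X 1 0 = 0.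
  apply: (mulfI (x := D 0 0 - D 1 1)); rewrite ?subr_eq0 // mulr0.
  move/matrixP/(_ 1 0): DX; rewrite !mxE !sum2E D1 => /esym/eqP.
  by rewrite -subr_eq0 => /eqP E; rewrite -[RHS]E; ring.
suff -> : X = diag_mx (\row_i X i i) by exact: diag_mx_is_diag.
by apply: mx2P; rewrite !mxE /= ?mulr1n ?mulr0n.
Qed.

(** In the basis [e] the matrix of [P] is diagonal with distinct entries, otherwise
    [P] would be scalar; so [A] is diagonal in [e] exactly when it commutes with
    [P]. *)
Lemma diagonal_ops_axis e (P : 'M[C]_2) : orthonormal_bases e ->
  diagonal_ops e P -> pauli P != 0 -> diagonal_ops e = axis (pauli P).
Proof.
move=> /orthonormal_basesP UU /diagonal_opsE; set U := basis_mx e in UU *.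
set D := _ *m U => Dd P0; have UU' : U *m U^T^cj = 1%:M by apply: mulmx1C.
have conjU A : U *m (U^T^cj *m A *m U) *m U^T^cj = A.
  by rewrite !mulmxA UU' mul1mx -mulmxA UU' mulmx1.
have D01 : D 0 0 != D 1 1.
  apply: contra_neq P0 => D01; rewrite -[P]conjU -/D.
  have -> : D = (D 0 0)%:M.
    move/is_diag_mxP: Dd => Dd; apply: mx2P; rewrite [RHS]mxE /= ?mulr1n ?mulr0n //;
    exact: Dd.
  by rewrite mul_mx_scalar -scalemxAl UU' pauliZ pauli_scalar scaler0.
have mulU A B : (U^T^cj *m A *m U) *m (U^T^cj *m B *m U) = U^T^cj *m (A *m B) *m U.
  by rewrite !mulmxA -(mulmxA _ U) UU' mulmx1.
have H A : diagonal_ops e A <-> axis (pauli P) A.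
  rewrite diagonal_opsE -/U diag_commute; [|exact: Dd|exact: D01].
  rewrite !mulU /axis /= -pauli_commute.
  by split=> [E|-> //]; rewrite -[P *m A]conjU -[A *m P]conjU E.
by apply/seteqP; split=> A /H.
Qed.

Lemma diagonal_ops_axes : @diagonal_ops R @` @orthonormal_bases R = @real_axes R.
Proof.
apply/seteqP; split=> [_ [e eo <-]|_ [v /= v0 <-]].
  have := eo => /orthonormal_basesP; set U := basis_mx e => UU.
  (* [P] is Hermitian, so its Pauli coordinates are real; it is diagonal in [e] with
     eigenvalues 1 and -1. *)
  pose P := U *m sigma3 R *m U^T^cj.
  have UPU : U^T^cj *m P *m U = sigma3 R.
    by rewrite /P !mulmxA UU mul1mx -mulmxA UU mulmx1.
  have Pd : diagonal_ops e P.
    apply/diagonal_opsE; rewrite -/U UPU; apply/is_diag_mxP => i j ij.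
    by rewrite mxE -val_eqE (negPf ij).
  have P0 : pauli P != 0.
    apply/eqP => /pauli_eq0[a Pa]; move: UPU; rewrite Pa mul_mx_scalar -scalemxAl UU.
    move/matrixP => E; have := (E 0 0, E 1 1).
    rewrite !mxE /= mulr1n mulr1 => -[-> /eqP].
    by rewrite -addr_eq0 -mulr2n pnatr_eq0.
  rewrite (diagonal_ops_axis eo Pd P0).
  have [] // := @plane_axis_real _ (pauli P) P0.
  have s3 : (sigma3 R)^T^cj = sigma3 R.
    by apply: mx2P; rewrite !mxE /= ?rmorph0 ?rmorph1 ?rmorphN1.
  by rewrite pauli_hermitian ?crossxx // /P !trmx_mul !map_mxM map_conjTK s3 mulmxA.
(* Conversely [dot_sigma v] is Hermitian: diagonalise it in an orthonormal basis. *)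
pose P := dot_sigma v%:CV.
have Pn : P \is normalmx by apply/normalmxP; rewrite dot_sigma_hermitian.
have /orthomx_spectralP := Pn; set Q := spectralmx P => PQ.
have Qu : Q \is unitarymx by exact: spectral_unitarymx.
have QQ : Q *m Q^T^cj = 1%:M by exact/unitarymxP.
have [e eQ] := basis_mx_surj Q^T^cj.
have eo : orthonormal_bases e by apply/orthonormal_basesP; rewrite eQ map_conjTK.
have Pd : diagonal_ops e P.
  apply/diagonal_opsE; rewrite eQ map_conjTK PQ invmx_unitary // !mulmxA QQ mul1mx.
  by rewrite -mulmxA QQ mulmx1 diag_mx_is_diag.
exists e => //; rewrite -[v%:CV]dot_sigmaK; apply: diagonal_ops_axis => //.
by rewrite dot_sigmaK real_eq0.
Qed.

(** The unitary [V] taking [a] to [b], applied to [e]. It conjugates the operators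
    diagonal in [e] into those diagonal in [V e]. *)
Definition basis_transport (a b e : 2.-tuple H) : 2.-tuple H :=
  map_tuple (mulmx (basis_mx b *m (basis_mx a)^T^cj)) e.

Lemma basis_transportP (a b e : 2.-tuple H) :
  orthonormal_bases a -> orthonormal_bases b -> orthonormal_bases e ->
  diagonal_ops e = diagonal_ops a ->
  [/\ orthonormal_bases (basis_transport a b e),
      diagonal_ops (basis_transport a b e) = diagonal_ops b
    & basis_transport b a (basis_transport a b e) = e].
Proof.
move=> /orthonormal_basesP aa /orthonormal_basesP bb /orthonormal_basesP ee ea.
have aa' := mulmx1C aa.
rewrite /basis_transport; set V := _ *m _.
have VV : V^T^cj *m V = 1%:M.
  by rewrite /V trmx_mul map_mxM map_conjTK mulmxA -(mulmxA (basis_mx a)) bb mulmx1 aa'.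
have shift f A :
    diagonal_ops (map_tuple (mulmx V) f) A <-> diagonal_ops f (V^T^cj *m A *m V).
  by rewrite !diagonal_opsE basis_mx_map trmx_mul map_mxM !mulmxA.
split.
- apply/orthonormal_basesP; rewrite basis_mx_map trmx_mul map_mxM mulmxA.
  by rewrite -(mulmxA (basis_mx e)^T^cj) VV mulmx1.
- have Va : map_tuple (mulmx V) a = b.
    by apply: basis_mx_inj; rewrite basis_mx_map /V -mulmxA aa mulmx1.
  rewrite -[in RHS]Va; apply/seteqP.
  by split=> A /shift EA; apply/shift; rewrite ?ea // -ea.
- apply: basis_mx_inj; rewrite !basis_mx_map /V !mulmxA.
  by rewrite -(mulmxA (basis_mx a)) bb mulmx1 aa' mul1mx.
Qed.
End Bases.

(** * Lifting a permutation along a map with interchangeable fibres *)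

Section Transport.
Variables (X Y : Type) (E : set X) (D : X -> Y) (F G : Y -> Y).
Hypotheses (FK : cancel F G) (GK : cancel G F).
Variable t : X -> X -> X -> X.
Hypothesis tP : forall a b e, E a -> E b -> E e -> D e = D a ->
  [/\ E (t a b e), D (t a b e) = D b & t b a (t a b e) = e].

(** The transports [t a b] identify the fibre of [D] through [a] with the fibre
    through [b].  Choosing one representative in each fibre, [phi] transports the
    fibre over [y] to the fibre over [F y] along the chosen representatives, and
    [t b a] undoes [t a b]. *)
Lemma lift_bijP (x0 : X) :
  (exists2 phi, set_bij E E phi & forall e, E e -> F (D e) = D (phi e)) <->
  (forall y, (D @` E) (F y) <-> (D @` E) y).
Proof.
split=> [[phi [phiE _ phiS] Fphi] y|FE].
  split=> [[e' Ee' e'y]|[e Ee <-]]; last by exists (phi e); [exact: phiE|rewrite Fphi].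
  have [e Ee phie] := phiS e' Ee'; exists e => //.
  by apply: (can_inj FK); rewrite Fphi // phie.
have /choice[rep repP] : forall y, exists x, (D @` E) y -> E x /\ D x = y.
  move=> y; have [[x Ex xy]|Ey] := pselect ((D @` E) y); first by exists x.
  by exists x0 => /Ey.
have FD e : E e -> (D @` E) (F (D e)) by move=> Ee; apply/FE; exists e.
pose phi e := t (rep (D e)) (rep (F (D e))) e.
have phiP e : E e -> [/\ E (phi e), D (phi e) = F (D e)
    & t (rep (F (D e))) (rep (D e)) (phi e) = e].
  move=> Ee; have [Ea aD] := repP (D e) (ex_intro2 _ _ e Ee erefl).
  by have [Eb bD] := repP _ (FD e Ee); have [] := tP Ea Eb Ee (esym aD); rewrite bD.
exists phi => [|e /phiP[_ -> //]].
split=> [e /phiP[]//|e f /set_mem Ee /set_mem Ef ef|e' Ee'].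
  have [[_ De eK] [_ Df fK]] := (phiP e Ee, phiP f Ef).
  have DE : D e = D f by apply: (can_inj FK); rewrite -De -Df ef.
  by rewrite -eK -fK ef DE.
(* The preimage of [e'] is its transport back to the fibre over [G (D e')]. *)
have GE : (D @` E) (G (D e')) by apply/FE; rewrite GK; exists e'.
have [Ea aD] := repP _ GE; have [Eb bD] := repP (D e') (ex_intro2 _ _ e' Ee' erefl).
have [Ee De eK] := tP Eb Ea Ee' (esym bD).
by exists (t (rep (D e')) (rep (G (D e'))) e') => //; rewrite /phi De aD GK.
Qed.

End Transport.

Definition permutes_under {X : Type} (f : X -> X) (F : set (set X)) : Prop :=
  forall P, F (f @` P) <-> F P.

Lemma image_cancel (X Y : Type) (f : X -> Y) (g : Y -> X) :
  cancel f g -> cancel (fun P => f @` P) (fun Q => g @` Q).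
Proof.
move=> fK P; apply/seteqP; split=> [_ [_ [x Px <-] <-]|x Px]; first by rewrite fK.
by exists (f x); [exists x|rewrite fK].
Qed.

(** * Linear bijections permuting planes or axes *)

Section LinearPreservers.
Variable R : realType.
Local Notation C := R[i].
Local Notation "A ^cj" := (map_mx Num.conj A) (at level 2, format "A ^cj").
Local Notation "v %:CV" := (map_mx (real_complex R) v) (at level 2, format "v %:CV").
Variables (T : {linear 'M[C]_2 -> 'M[C]_2}) (Ti : 'M[C]_2 -> 'M[C]_2).
Hypotheses (TK : cancel T Ti) (TiK : cancel Ti T).

Lemma permutes_planes_axes :
  permutes_under T (@real_planes R) -> permutes_under T (@real_axes R).
Proof.
have TI P Q : T @` (P `&` Q) = T @` P `&` T @` Q.
  apply/seteqP; split=> [_ [A [PA QA] <-]|_ [[A PA <-] [B QB /(can_inj TK) BA]]].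
    by split; exists A.
  by exists A => //; split=> //; rewrite -BA.
move=> TP L; rewrite real_axes_planes; split=> -[P [Q [RP RQ PQ]]].
  move=> TL; exists (Ti @` P), (Ti @` Q); split.
  - by apply/TP; rewrite (image_cancel TiK).
  - by apply/TP; rewrite (image_cancel TiK).
  - by move/(can_inj (image_cancel TiK)).
  - by apply: (can_inj (image_cancel TK)); rewrite TI !(image_cancel TiK).
move=> ->; exists (T @` P), (T @` Q); split; rewrite ?TI //; try exact/TP.
by move/(can_inj (image_cancel TK)).
Qed.

(** In the basis formed by the identity and the Pauli matrices, [T] is block
    triangular with diagonal blocks [c] and [lambda B]. *)
Definition triangular_form :=
  exists (c lambda : C) (l : {scalar 'cV[C]_3}) (B : 'M[R]_3),
  [/\ c != 0, lambda != 0, B \in unitmx &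
    forall (a : C) (x : 'cV[C]_3),
      T (a *: 1%:M + dot_sigma x) =
      (c * a) *: 1%:M + l x *: 1%:M + lambda *: dot_sigma (B%:CV *m x)].

Lemma permutes_axes_triangular : permutes_under T (@real_axes R) -> triangular_form.
Proof.
move=> TA.
(* [1] lies in every axis, so [T 1] does too, and it must be scalar. *)
have T1 : pauli (T 1%:M) = 0.
  apply/eqP; apply: contraT => /cross_delta_neq0[k]; rewrite crossC oppr_eq0.
  have ek0 : delta_mx k 0 != 0 :> 'cV[R]_3.
    by apply/cV0Pn; exists k; rewrite mxE !eqxx oner_eq0.
  have /TA[] : @real_axes R (T @` (Ti @` axis (delta_mx k 0 : 'cV[R]_3)%:CV)).
    by rewrite (image_cancel TiK); exists (delta_mx k 0).
  move=> u /= u0 /(congr1 (fun P => T @` P)).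
  rewrite (image_cancel TiK) map_delta_mx => E.
  have : axis (delta_mx k 0) (T 1%:M).
    by rewrite -E; exists 1%:M => //; rewrite /axis /= pauli_scalar cross0r.
  by rewrite /axis /= => ->; rewrite eqxx.
have [c Tc] := pauli_eq0 T1.
have c0 : c != 0.
  apply/eqP => c0; move: Tc; rewrite c0 raddf0 -(raddf0 T) => /(can_inj TK)/eqP.
  by rewrite oner_eq0.
have Ts a : T a%:M = (c * a)%:M.
  by rewrite -scalemx1 linearZ /= Tc scale_scalar_mx mulrC.
have [A TAx] : exists A, forall x, pauli (T (dot_sigma x)) = A *m x.
  apply: (@linear_mx _ _ _ (fun x => pauli (T (dot_sigma x)))) => a x y.
  by rewrite dot_sigmaD dot_sigmaZ linearD linearZ pauliD pauliZ.
(* If [A x = 0], then [T (dot_sigma x)] is scalar, hence the image of a scalar. *)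
have Au : A \in unitmx.
  apply: unitmx_ker0 => x; rewrite -TAx => /pauli_eq0[s Ts'].
  rewrite -[x]dot_sigmaK -(pauli_scalar (s / c)); congr pauli.
  by apply: (can_inj TK); rewrite Ts' Ts mulrC divfK.
have [|lambda [B [l0 Bu AB]]] := real_up_to_scalar Au.
  move=> v v0; have /TA[w /= w0 TL] : @real_axes R (axis v%:CV) by exists v.
  have : axis w%:CV (T (dot_sigma v%:CV)).
    by rewrite TL; exists (dot_sigma v%:CV) => //; rewrite /axis /= dot_sigmaK crossxx.
  rewrite /axis /= TAx => /cross_eq0; rewrite real_eq0 => /(_ w0)[z ->].
  by exists z, w.
(* Half the trace, the scalar part of [T (dot_sigma x)]. *)
pose lf (x : 'cV[C]_3) := (T (dot_sigma x) 0 0 + T (dot_sigma x) 1 1) / 2.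
have lfP : scalar lf.
  by move=> a x y; rewrite /lf dot_sigmaD dot_sigmaZ linearD linearZ !mxE; field.
pose l : {scalar _} := HB.pack lf (GRing.isLinear.Build _ _ _ _ lf lfP).
exists c, lambda, l, B; split=> // a x.
rewrite linearD /= !scalemx1 Ts -addrA; congr (_ + _).
by rewrite [LHS]pauli_decomp TAx AB -scalemxAl dot_sigmaZ.
Qed.

Lemma triangular_permutes_planes : triangular_form -> permutes_under T (@real_planes R).
Proof.
move=> [c [lambda [l [B [c0 l0 Bu TE]]]]].
have pT A : pauli (T A) = lambda *: (B%:CV *m pauli A).
  rewrite {1}[A]pauli_decomp -scalemx1 TE !scalemx1 !pauliD !pauli_scalar !add0r.
  by rewrite pauliZ dot_sigmaK.
have Tplane w : T @` plane (B^T *m w)%:CV = plane w%:CV.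
  have H A : plane w%:CV (T A) <-> plane (B^T *m w)%:CV A.
    rewrite /plane /= pT dotZr dot_mulmx map_mxM map_trmx.
    by split=> [/eqP|->]; rewrite ?mulr0 // mulf_eq0 (negPf l0) => /eqP.
  apply/seteqP; split=> [_ [A /H wA <-]//|A wA].
  by exists (Ti A) => //; apply/H; rewrite TiK.
have BTu : B^T \in unitmx by rewrite unitmx_tr.
have nz u : u != 0 -> B^T *m u != 0.
  by apply: contra_neq => Bu0; rewrite -(mulKmx BTu u) Bu0 mulmx0.
move=> P; split=> [[w /= w0 wP]|[u /= u0 <-]].
  exists (B^T *m w); first exact: nz.
  by apply: (can_inj (image_cancel TK)); rewrite Tplane.
exists (invmx B^T *m u) => /=; last by rewrite -Tplane mulKVmx.
by apply: contra_neq u0 => Bu0; rewrite -(mulKVmx BTu u) Bu0 mulmx0.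
Qed.
End LinearPreservers.

(** * The equivalence *)

Theorem theorem5 (R : realType) (T : {linear 'M[R[i]]_2 -> 'M[R[i]]_2})
    (T_bij : bijective T) :
  [<-> (exists2 psi : ('cV[R[i]]_2 -> 'cV[R[i]]_2) -> ('cV[R[i]]_2 -> 'cV[R[i]]_2),
          set_bij (@Conj R) (@Conj R) psi &
          forall J, Conj J -> T @` symmetric_ops J = symmetric_ops (psi J));
       (exists2 phi : 2.-tuple 'cV[R[i]]_2 -> 2.-tuple 'cV[R[i]]_2,
          set_bij (@orthonormal_bases R) (@orthonormal_bases R) phi &
          forall e, orthonormal_bases e ->
            T @` diagonal_ops e = diagonal_ops (phi e));
       (exists (c lambda : R[i]) (l : {scalar 'cV[R[i]]_3}) (B : 'M[R]_3),
          [/\ c != 0, lambda != 0, B \in unitmx &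
              forall (a : R[i]) (x : 'cV[R[i]]_3),
                T (a *: 1%:M + dot_sigma x) =
                  (c * a) *: 1%:M + l x *: 1%:M
                  + lambda *: dot_sigma (map_mx (real_complex R) B *m x)])].
Proof.
have [Ti TK TiK] := T_bij.
have conjP := lift_bijP (t := fun a b e : 'cV[R[i]]_2 -> 'cV[R[i]]_2 => e \o a \o b)
  (image_cancel TK) (image_cancel TiK)
  (@conj_transport R) (fun x => x).
have baseP := lift_bijP (image_cancel TK) (image_cancel TiK)
  (@basis_transportP R) [tuple 0; 0].
rewrite symmetric_ops_planes in conjP; rewrite diagonal_ops_axes in baseP.
tfae.
- by move=> /(conjP.1) /(permutes_planes_axes TK TiK) /(baseP.2).
- by move=> /(baseP.1) /(permutes_axes_triangular TK TiK).
- by move=> /(triangular_permutes_planes TK TiK) /(conjP.2).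
Qed.
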